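(* The formal exponential map restricts to a well-defined map $\mathbf{vect}^\circ\to\mathbf{Diff}^\circ$; that is, for every $\mathcal{L}\in\mathbf{vect}^\circ$ one has $\exp(\mathcal{L})\in\mathbf{Diff}^\circ$.
   Context: $\overline{\mathbf{Diff}}$ is the group (under substitution) of formal power series $\gamma(x)=x+\sum_{j\ge 2}a_jx^j$, $a_j\in\mathbb{R}$. $\overline{\mathbf{vect}}$ is the Lie algebra of formal vector fields $\mathcal{L}=\sum_{j\ge 1}b_jL_j$, $b_j\in\mathbb{R}$, $L_j=x^{j+1}\frac{d}{dx}$, acting on $\overline V=\mathbb{R}[[x]]$. For $\sigma>0$: $\mathbf{Diff}_\sigma$ is the set of $\gamma\in\overline{\mathbf{Diff}}$ with $\sum_{j\ge2}\frac{|a_j|\sigma^{j-1}}{j!}<\infty$, and $\mathbf{vect}_\sigma$ is the set of $\mathcal{L}\in\overline{\mathbf{vect}}$ with $\sum_{j\ge1}\frac{|b_j|\sigma^{j}}{(j+1)!}<\infty$. Set $\mathbf{Diff}^\circ=\bigcap_{\sigma>0}\mathbf{Diff}_\sigma$ and $\mathbf{vect}^\circ=\bigcap_{\sigma>0}\mathbf{vect}_\sigma$. Formal exponential: for $\gamma\in\overline{\mathbf{Diff}}$ let $T(\gamma)F(x)=F(\gamma(x))$ for $F\in\overline V$. For $\mathcal{L}\in\overline{\mathbf{vect}}$ the operator $\sum_{k\ge0}\mathcal{L}^k/k!$ on $\overline V$ is well defined and equals $T(\gamma)$ for a unique $\gamma\in\overline{\mathbf{Diff}}$ (a known fact), denoted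 $\exp(\mathcal{L})$. *)

(* Defs.v *)
From HB Require Import structures.
From mathcomp Require Import all_boot all_order all_algebra.
From mathcomp Require Import all_classical all_reals all_analysis.
Set Implicit Arguments.
Unset Strict Implicit.
Unset Printing Implicit Defensive.
Import Order.TTheory GRing.Theory Num.Theory.
Local Open Scope classical_set_scope.
Local Open Scope ring_scope.

Section FormalPowerSeries.
Context {R : realType}.

Definition fps : Type := nat -> R.

Implicit Types F G g : fps.

Definition fpsX : fps := fun n => (n == 1%N)%:R.
Definition fps1 : fps := fun n => (n == 0%N)%:R.

Definition fps_mul F G : fps := fun n => \sum_(i < n.+1) F i * G (n - i)%N.

Definition fps_pow F k : fps := iter k (fps_mul F) fps1.

Definition fps_deriv F : fps := fun n => n.+1%:R * F n.+1.

(* Only meaningful when [g 0 = 0]: then [g ^ k] has no term of degree less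
   than [k], which justifies stopping the sum at [k = n]. *)
Definition fps_comp F g : fps := fun n => \sum_(k < n.+1) F k * fps_pow g k n.

(* Each coefficient of the partial sums is eventually constant: convergence
   in the (x)-adic topology of R[[x]]. *)
Definition fps_sum (u : nat -> fps) F : Prop :=
  forall n, exists K, forall N, (K <= N)%N -> \sum_(k < N) u k n = F n.

End FormalPowerSeries.
Arguments fps R : clear implicits.

Record Diff (R : realType) := MkDiff {
  Diff_coef :> nat -> R;
  Diff_coef0 : Diff_coef 0 = 0;
  Diff_coef1 : Diff_coef 1 = 1 }.

(* The field sum_(j >= 1) b_j L_j is given by the sequence (b_j); the entry of
   index 0, which would be the coefficient of L_0, is required to vanish. *)
Record vect (R : realType) := MkVect {
  vect_coef :> nat -> R;
  vect_coef0 : vect_coef 0 = 0 }.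

Section Exponential.
Context {R : realType}.
Implicit Types (L : vect R) (g : Diff R) (F : fps R).

(* sum_(j >= 1) b_j x^(j+1), the component of the field along d/dx *)
Definition vect_ser L : fps R := fun n => if n is j.+1 then L j else 0.

Definition vect_act L F : fps R := fps_mul (vect_ser L) (fps_deriv F).

Definition T_op g F : fps R := fps_comp F g.

Definition is_fexp L g : Prop :=
  forall F,
  fps_sum (fun k n => (k`!%:R)^-1 * iter k (vect_act L) F n) (T_op g F).

(* Existence is proved by truncating to polynomials: [fps_agree N F P] says that
   [F] and [P] coincide modulo x^N. *)
Definition fps_agree N (F : fps R) (P : {poly R}) :=
  forall i, (i < N)%N -> F i = P`_i.

Lemma fps_agree_mul N (F G : fps R) P Q :
  fps_agree N F P -> fps_agree N G Q -> fps_agree N (fps_mul F G) (P * Q).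
Proof.
move=> hF hG n ltnN; rewrite /fps_mul coefM; apply: eq_bigr => i _.
rewrite hF ?hG //; first exact: leq_ltn_trans (leq_subr _ _) ltnN.
exact: leq_ltn_trans (leq_ord i) ltnN.
Qed.

Lemma fps_agree_pow N (F : fps R) P k :
  fps_agree N F P -> fps_agree N (fps_pow F k) (P ^+ k).
Proof.
move=> h; elim: k => [|k IHk]; first by move=> n _; rewrite coef1.
by rewrite exprS; exact: fps_agree_mul h IHk.
Qed.

Lemma fps_compX (F : fps R) : F 0 = 0 -> forall n, fps_comp fpsX F n = F n.
Proof.
move=> F0 [|n]; first by rewrite /fps_comp big_ord1 mul0r F0.
rewrite /fps_comp !big_ord_recl big1 => [|i _]; last by rewrite mul0r.
rewrite mul0r add0r addr0 mul1r lift0.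
have ag : fps_agree n.+2 F (\poly_(i < n.+2) F i).
  by move=> i lti; rewrite coef_poly lti.
by rewrite (fps_agree_pow 1 ag) // expr1 -ag.
Qed.

Definition polyvf (V P : {poly R}) := V * P^`().

Lemma polyvfM V P Q : polyvf V (P * Q) = polyvf V P * Q + P * polyvf V Q.
Proof. by rewrite /polyvf derivM mulrDr mulrA mulrCA. Qed.

Lemma polyvfZ V a P : polyvf V (a *: P) = a *: polyvf V P.
Proof. by rewrite /polyvf derivZ -scalerAr. Qed.

Lemma polyvf_sum V (I : Type) (r : seq I) (F : I -> {poly R}) :
  polyvf V (\sum_(i <- r) F i) = \sum_(i <- r) polyvf V (F i).
Proof.
rewrite /polyvf -mulr_sumr; congr (_ * _).
exact: (big_morph (@deriv R) (@derivD R) (@deriv0 R)).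
Qed.

Lemma polyvf_iter0 V k : iter k (polyvf V) 0 = 0.
Proof. by elim: k => //= k ->; rewrite /polyvf deriv0 mulr0. Qed.

Lemma fps_agree_act N L F V P : fps_agree N (vect_ser L) V -> fps_agree N F P ->
  fps_agree N (vect_act L F) (polyvf V P).
Proof.
move=> hV hF n ltnN; rewrite /vect_act /fps_mul coefM; apply: eq_bigr => i _.
rewrite -hV; last exact: leq_ltn_trans (leq_ord i) ltnN.
case: i => -[|i] /= lti; first by rewrite !mul0r.
rewrite coef_deriv /fps_deriv hF ?mulr_natl //.
by rewrite -subSn // subSS (leq_ltn_trans (leq_subr _ _)).
Qed.

Lemma fps_agree_iter N L F V P k :
  fps_agree N (vect_ser L) V -> fps_agree N F P ->
  fps_agree N (iter k (vect_act L) F) (iter k (polyvf V) P).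
Proof. by move=> hV hF; elim: k => //= k; exact: fps_agree_act. Qed.

Definition ord_ge r (P : {poly R}) := forall i, (i < r)%N -> P`_i = 0.

Lemma ord_ge_mul r s P Q : ord_ge r P -> ord_ge s Q -> ord_ge (r + s) (P * Q).
Proof.
move=> hP hQ n ltn; rewrite coefM big1 // => i _.
have [ltir|leri] := ltnP i r; first by rewrite hP // mul0r.
rewrite hQ ?mulr0 // ltn_subLR ?leq_ord //.
by rewrite (leq_trans ltn) // leq_add2r.
Qed.

Definition polyvf_dp (V : {poly R}) k P := (k`!%:R)^-1 *: iter k (polyvf V) P.

Lemma ord_ge_dp V k r P : ord_ge 2 V -> ord_ge r P ->
  ord_ge (k + r) (polyvf_dp V k P).
Proof.
move=> hV hP n ltn; rewrite coefZ.
suff h : ord_ge (k + r) (iter k (polyvf V) P) by rewrite h ?mulr0.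
elim: k {n ltn} => //= k IHk n ltn.
apply: (@ord_ge_mul 2 (k + r).-1 V _ hV) => [i lti|].
  by rewrite coef_deriv IHk ?mul0rn // -ltn_predRL.
by move: ltn; rewrite addSn; case: (k + r)%N => [|m] /=; [case: n|].
Qed.

Lemma natrS_neq0 k : (k.+1%:R : R) != 0. Proof. by rewrite pnatr_eq0. Qed.

Lemma polyvf_dpS V k P :
  polyvf V (polyvf_dp V k P) = k.+1%:R *: polyvf_dp V k.+1 P.
Proof.
rewrite /polyvf_dp polyvfZ scalerA /= factS natrM invfM mulrA.
by rewrite divff // mul1r.
Qed.

Lemma polyvf_dpM V k P Q : polyvf_dp V k (P * Q) =
  \sum_(i < k.+1) polyvf_dp V i P * polyvf_dp V (k - i) Q.
Proof.
elim: k => [|k IHk].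
  by rewrite big_ord1 subnn /polyvf_dp /= fact0 invr1 !scale1r.
apply: (scalerI (natrS_neq0 k)); rewrite -polyvf_dpS IHk polyvf_sum.
pose f i := polyvf_dp V i P * polyvf_dp V (k.+1 - i) Q.
transitivity (\sum_(i < k.+1) (i.+1%:R *: f i.+1 + (k.+1 - i)%:R *: f i)).
  apply: eq_bigr => i _.
  rewrite polyvfM !polyvf_dpS -subSn ?leq_ord // -(scalerAl i.+1%:R).
  by rewrite -(scalerAr (k.+1 - i)%:R).
transitivity (\sum_(i < k.+2) (i%:R *: f i + (k.+1 - i)%:R *: f i)); last first.
  rewrite scaler_sumr; apply: eq_bigr => i _.
  by rewrite -scalerDl -natrD subnKC // leq_ord.
rewrite !big_split /= [X in _ = X + _]big_ord_recl scale0r add0r.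
by rewrite [X in _ = _ + X]big_ord_recr /= subnn scale0r addr0.
Qed.

Definition polyvf_exp (V : {poly R}) N P := \sum_(k < N) polyvf_dp V k P.

Lemma polyvf_expM V N P Q : ord_ge 2 V ->
  forall n, (n < N)%N -> (polyvf_exp V N (P * Q))`_n =
    (polyvf_exp V N P * polyvf_exp V N Q)`_n.
Proof.
move=> hV n ltnN.
pose S (P : {poly R}) : {poly {poly R}} := \poly_(k < N) polyvf_dp V k P.
have SE P' : polyvf_exp V N P' = (S P').[1].
  rewrite horner_poly; apply: eq_bigr => k _; by rewrite expr1n mulr1.
rewrite [in RHS]SE [in RHS]SE -hornerM.
have sz : (size (S P * S Q)%R <= N + N)%N.
  apply: leq_trans (size_polyMleq _ _) _; apply: leq_trans (leq_pred _) _.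
  by apply: leq_add; exact: size_poly.
rewrite (horner_coef_wide _ sz) big_split_ord /= coefD.
rewrite [X in _ = _ + X](_ : _ = 0) ?addr0; last first.
  rewrite coef_sum big1 // => k _; rewrite expr1n mulr1 coefM coef_sum big1 //.
  move=> i _; rewrite !coef_poly.
  have ltn : (n < i + (N + k - i))%N.
    by rewrite subnKC ?leq_ord // (leq_trans ltnN) // leq_addr.
  have DM : (polyvf_dp V i P * polyvf_dp V (N + k - i) Q)`_n = 0.
    by apply: ord_ge_mul ltn; rewrite -[X in ord_ge X _]addn0; exact: ord_ge_dp.
  by case: ifP => _; case: ifP => _ //; rewrite ?(mul0r, mulr0) ?coef0.
apply: (congr1 (fun p : {poly R} => p`_n)); apply: eq_bigr => k _.
rewrite expr1n mulr1 coefM polyvf_dpM.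
apply: eq_bigr => i _; rewrite !coef_poly.
rewrite (leq_ltn_trans (leq_ord i) (ltn_ord k)).
by rewrite (leq_ltn_trans (leq_subr _ _) (ltn_ord k)).
Qed.

Lemma polyvf_expX V N i n : ord_ge 2 V -> (n < N)%N ->
  (polyvf_exp V N ('X ^+ i))`_n = (polyvf_exp V N 'X ^+ i)`_n.
Proof.
move=> hV; elim: i n => [|i IHi] n ltnN.
  case: N ltnN => // N _; rewrite /polyvf_exp !expr0 big_ord_recl big1 ?addr0.
    by rewrite /polyvf_dp /= fact0 invr1 scale1r.
  move=> k _; rewrite /polyvf_dp lift0 iterSr.
  by rewrite [X in iter _ _ X](_ : _ = 0) ?polyvf_iter0 ?scaler0 //
     /polyvf -polyC1 derivC mulr0.
rewrite !exprS polyvf_expM // !coefM; apply: eq_bigr => j _; rewrite IHi //.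
exact: leq_ltn_trans (leq_subr _ _) ltnN.
Qed.

Lemma polyvf_dp_sum V k N (F : fps R) :
  polyvf_dp V k (\poly_(i < N) F i) = \sum_(i < N) F i *: polyvf_dp V k 'X^i.
Proof.
rewrite /polyvf_dp poly_def.
under [RHS]eq_bigr do rewrite scalerA mulrC -scalerA.
rewrite -scaler_sumr; congr (_ *: _).
elim: k => //= k ->; rewrite polyvf_sum.
by apply: eq_bigr => i _; rewrite polyvfZ.
Qed.

Lemma polyvf_exp_comp V N (F : fps R) n : ord_ge 2 V -> (n < N)%N ->
  (polyvf_exp V N (\poly_(i < N) F i))`_n =
    \sum_(i < N) F i * (polyvf_exp V N 'X ^+ i)`_n.
Proof.
move=> hV ltnN; rewrite /polyvf_exp; under eq_bigr do rewrite polyvf_dp_sum.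
rewrite exchange_big coef_sum; apply: eq_bigr => i _.
by rewrite -scaler_sumr coefZ -polyvf_expX.
Qed.

Definition fps_trunc N (F : fps R) : {poly R} := \poly_(i < N) F i.

Lemma fps_agree_trunc N F : fps_agree N F (fps_trunc N F).
Proof. by move=> i lti; rewrite coef_poly lti. Qed.

Lemma ord_ge_vect N L : ord_ge 2 (fps_trunc N (vect_ser L)).
Proof.
by move=> [|[|i]] // _; rewrite coef_poly; case: ifP => //= _;
   exact: vect_coef0.
Qed.

Lemma vect_act_series L N n F P M : (n < N)%N -> fps_agree N F P -> (n < M)%N ->
  \sum_(k < M) (k`!%:R)^-1 * iter k (vect_act L) F n
  = (polyvf_exp (fps_trunc N (vect_ser L)) N P)`_n.
Proof.
move=> ltnN hF ltnM; set V := fps_trunc _ _.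
have hk k : (k`!%:R)^-1 * iter k (vect_act L) F n = (polyvf_dp V k P)`_n.
  by rewrite coefZ (fps_agree_iter k (fps_agree_trunc _) hF).
under eq_bigr do rewrite hk.
have h0 K : (n < K)%N ->
  \sum_(k < K) (polyvf_dp V k P)`_n = \sum_(k < n.+1) (polyvf_dp V k P)`_n.
  move=> ltnK; rewrite -(subnKC ltnK) big_split_ord /= [X in _ + X]big1 ?addr0 //.
  move=> k _; apply: (@ord_ge_dp _ _ 0) => //; first exact: ord_ge_vect.
  by rewrite addn0 leq_addr.
by rewrite h0 // coef_sum h0.
Qed.

Lemma fexp_exists_unique L : exists! g : Diff R, is_fexp L g.
Proof.
pose c : fps R := fun n =>
  \sum_(k < n.+1) (k`!%:R)^-1 * iter k (vect_act L) fpsX n.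
have agX N : fps_agree N fpsX 'X by move=> i _; rewrite coefX.
have cE N : fps_agree N c (polyvf_exp (fps_trunc N (vect_ser L)) N 'X).
  by move=> n ltnN; rewrite /c (vect_act_series L ltnN (agX N)).
have X1 : ord_ge 1 'X by case=> // _; rewrite coefX.
have c0 : c 0 = 0.
  rewrite (cE 1) // /polyvf_exp big_ord1.
  by rewrite /polyvf_dp /= fact0 invr1 scale1r coefX.
have c1 : c 1 = 1.
  rewrite (cE 2) // /polyvf_exp big_ord_recl big_ord1 coefD.
  rewrite [X in _ + X](ord_ge_dp (@ord_ge_vect 2 L) X1) // addr0.
  by rewrite /polyvf_dp /= fact0 invr1 scale1r coefX.
exists (MkDiff c0 c1); split=> [F n|g hg].
  exists n.+1 => N ltnN.
  rewrite (vect_act_series L (ltnSn n) (@fps_agree_trunc _ F) ltnN).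
  rewrite polyvf_exp_comp //; last exact: ord_ge_vect.
  by apply: eq_bigr => i _ /=; rewrite (fps_agree_pow i (cE n.+1)).
have cg : c = g :> fps R.
  apply/funext => n; have [K hK] := hg fpsX n.
  have := hK (maxn K n.+1) (leq_maxl _ _).
  rewrite (vect_act_series L (ltnSn n) (agX _)) ?leq_maxr // -cE // => ->.
  exact: fps_compX (Diff_coef0 g) n.
case: g hg cg => d d0 d1 _ /= cd; subst d.
by congr MkDiff; exact: Prop_irrelevance.
Qed.

Lemma fexp_exists L : exists g : Diff R, is_fexp L g.
Proof. by have [g [hg _]] := fexp_exists_unique L; exists g. Qed.

Definition fexp L : Diff R := sval (cid (fexp_exists L)).

Lemma fexpP L : is_fexp L (fexp L).
Proof. exact: svalP (cid (fexp_exists L)). Qed.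

End Exponential.

Section Subspaces.
Context {R : realType}.

Definition Diff_at (s : R) : set (Diff R) := [set g : Diff R |
  (\sum_(2 <= j <oo) (`|g j| * s ^+ j.-1 / j`!%:R)%:E < +oo)%E].

Definition vect_at (s : R) : set (vect R) := [set L : vect R |
  (\sum_(1 <= j <oo) (`|L j| * s ^+ j / (j.+1)`!%:R)%:E < +oo)%E].

Definition Diff_circ : set (Diff R) :=
  \bigcap_(s in [set s : R | 0 < s]) Diff_at s.

Definition vect_circ : set (vect R) :=
  \bigcap_(s in [set s : R | 0 < s]) vect_at s.

End Subspaces.

(* Main.v *)
Require Import Defs.
From mathcomp Require Import all_boot all_order all_algebra.
From mathcomp Require Import all_classical all_reals all_analysis.
From mathcomp Require Import ring.
Set Implicit Arguments.
Unset Strict Implicit.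
Unset Printing Implicit Defensive.
Import Order.TTheory GRing.Theory Num.Theory.
Local Open Scope ring_scope.

(* For a fixed [s > 0] put [|F| := sum_n |F_n| s^(n-1) / n!].  Since
   [m m! j! <= (m + j)!], a vector field acts as a bounded operator:
   [|L F| <= B |F|] with [B := sum_j |b_j| s^j / j!], which is finite because
   [L] also lies in [vect_(2s)] and [j + 1 <= 2^j].  Hence
   [|exp(L) x| <= sum_k B^k / k! * |x| = e^B]. *)

(** Each step in [j] multiplies the left by [j + 2] and the right by the larger [m + j + 2]. With
    [0] in place of [j.+1] the bound would fail for [m >= 2]. *)
Lemma mul_fact_leq m j : (m * (m`! * (j.+1)`!) <= (m + j.+1)`!)%N.
Proof.
elim: j => [|j IHj].
  by rewrite muln1 addn1 factS leq_mul2r leqnSn orbT.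
rewrite addnS [(j.+2)`!]factS [((m + j.+1).+1)`!]factS !(mulnCA _ j.+2).
by apply: leq_mul IHj; rewrite ltnS leq_addl.
Qed.

(** Truncated at [N], so that no convergence question arises. Since [0.-1 = 0], the constant term
    gets weight 1. *)
Definition wnorm {R : realType} (s : R) N (F : fps R) : R :=
  \sum_(n < N) `|F n| * (s ^+ n.-1 / n`!%:R).

(** The left side sums [u i * v j] over the triangle [i + j < N], which lies in the square
    [i, j < N]. *)
Lemma cauchy_prod_le {R : realDomainType} {u v : nat -> R} N :
  (forall i, 0 <= u i) -> (forall i, 0 <= v i) ->
  \sum_(n < N) \sum_(i < n.+1) u i * v (n - i)%N <=
  (\sum_(i < N) u i) * \sum_(i < N) v i.
Proof.
move=> u0 v0.
under eq_bigr => n _ do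
  rewrite -(big_mkord xpredT (fun i => u i * v (n - i)%N))
    (big_nat_widen _ _ N) ?ltn_ord //= big_mkord.
rewrite (exchange_big_dep xpredT) //= mulr_suml; apply: ler_sum => i _.
rewrite -mulr_sumr ler_wpM2l //.
rewrite -(big_mkord (fun n => i < n.+1)%N (fun n => v (n - i)%N)).
rewrite -(big_mkord xpredT v) (@big_cat_nat _ _ _ i) ?(ltnW (ltn_ord i)) //=.
rewrite [X in X + _]big1_seq ?add0r; last first.
  by move=> n /andP[]; rewrite mem_index_iota ltnS /= => /leq_gtF ->.
(* Shifting by [i] turns the inner sum into an initial segment of the sum of [v]. *)
rewrite -{1}[i : nat]add0n big_addn.
under eq_bigr do rewrite addnK.
rewrite [leRHS](@big_cat_nat _ _ _ (N - i)) ?leq_subr //=.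
rewrite -[leLHS]addr0; apply: lerD; last exact: sumr_ge0.
by rewrite big_mkcond; apply: ler_sum => n _; case: ifP.
Qed.

Section ExpBound.
Context {R : realType} (L : vect R) (s : R).
Hypothesis s0 : 0 < s.

Lemma vect_act_coef (F : fps R) n :
  vect_act L F n.+1 = \sum_(j < n.+1) L j * ((n.+1 - j)%:R * F (n.+1 - j)%N).
Proof.
rewrite /vect_act /fps_mul big_ord_recl mul0r add0r; apply: eq_bigr => j _.
by rewrite /fps_deriv lift0 subSS -subSn ?leq_ord.
Qed.

(** Termwise comparison with a Cauchy product: for [j + m = n + 1] with [j, m > 0] the powers of [s]
    match exactly, and [mul_fact_leq] absorbs the factor [m] coming from the derivative. *)
Lemma wnorm_vect_act N (F : fps R) :
  wnorm s N (vect_act L F) <=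
  (\sum_(j < N) `|L j| * (s ^+ j / j`!%:R)) * wnorm s N F.
Proof.
have w0 k n : 0 <= s ^+ k / n`!%:R :> R by rewrite divr_ge0 ?exprn_ge0 ?ltW.
apply: le_trans
  (cauchy_prod_le (u := fun j => `|L j| * (s ^+ j / j`!%:R))
    (v := fun n => `|F n| * (s ^+ n.-1 / n`!%:R)) N _ _);
  [|by move=> i; rewrite mulr_ge0..].
apply: ler_sum => -[[|n] ltnN] _ /=.
  by rewrite big_ord1 /vect_act /fps_mul big_ord1 mul0r normr0 mul0r !mulr_ge0.
(* The extra term of the Cauchy product involves [F 0], which the derivative kills; it is
   nonnegative. *)
rewrite vect_act_coef [leRHS]big_ord_recr -[leLHS]addr0 /=.
apply: lerD; last by do !apply: mulr_ge0 => //.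
apply: le_trans (ler_wpM2r (w0 _ _) (ler_norm_sum _ _ _)) _.
rewrite mulr_suml; apply: ler_sum => -[j ltjn] _ /=.
case: j ltjn => [|j] ltjn; first by rewrite vect_coef0 !(normr0, mul0r).
rewrite !normrM normr_nat subSS; set m := (n - j)%N.
have nE : n = (m + j)%N by rewrite subnK // -ltnS ltnW.
have m0 : (0 < m)%N by rewrite subn_gt0.
have sE : s ^+ n = s ^+ j.+1 * s ^+ m.-1.
  by rewrite -exprD nE; congr (_ ^+ _); rewrite addSnnS prednK // addnC.
have key : (m%:R : R) / (n.+1)`!%:R <= (j.+1)`!%:R^-1 / m`!%:R.
  rewrite ler_pdivrMr ?ltr0n ?fact_gt0 // -invfM mulrC -natrM.
  rewrite ler_pdivlMr ?ltr0n ?muln_gt0 ?fact_gt0 // -natrM ler_nat.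
  by rewrite nE -addnS [((j.+1)`! * _)%N]mulnC mul_fact_leq.
have -> : `|L j.+1| * (m%:R * `|F m|) * (s ^+ n.+1.-1 / (n.+1)`!%:R) =
  (`|L j.+1| * `|F m| * s ^+ n) * (m%:R / (n.+1)`!%:R) by rewrite /=; ring.
have -> : `|L j.+1| * (s ^+ j.+1 / (j.+1)`!%:R) *
    (`|F m| * (s ^+ m.-1 / m`!%:R)) =
  (`|L j.+1| * `|F m| * s ^+ n) * ((j.+1)`!%:R^-1 / m`!%:R).
  by rewrite sE; ring.
by rewrite ler_wpM2l // !mulr_ge0 // exprn_ge0 // ltW.
Qed.

Lemma wnorm_fexp B N : (forall M, \sum_(j < M) `|L j| * (s ^+ j / j`!%:R) <= B) ->
  wnorm s N (fexp L) <= expR B.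
Proof.
move=> leB; have B0 : 0 <= B by rewrite (le_trans _ (leB 0%N)) ?big_ord0.
have w0 k n : 0 <= s ^+ k / n`!%:R :> R by rewrite divr_ge0 ?exprn_ge0 ?ltW.
have wn0 F : 0 <= wnorm s N F by apply: sumr_ge0 => i _; rewrite mulr_ge0.
have normX : wnorm s N fpsX <= 1.
  rewrite /wnorm; case: N {wn0} => [|[|N]]; rewrite ?big_ord0 ?big_ord1 ?ler01 //.
    by rewrite /fpsX normr0 mul0r ler01.
  rewrite 2!big_ord_recl big1 /= => [|i _]; last by rewrite /fpsX /= normr0 mul0r.
  by rewrite /fpsX /= normr0 normr1 mul0r add0r addr0 mul1r divr1.
have normk k : wnorm s N (iter k (vect_act L) fpsX) <= B ^+ k.
  elim: k => //= k IHk; apply: le_trans (wnorm_vect_act _ _) _.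
  by rewrite exprS ler_pM // sumr_ge0 // => i _; rewrite mulr_ge0.
(* [L^k x] has order at least [k + 1], so the first [N] terms of the exponential series already give
   every coefficient below [N]. *)
have coefE n : (n < N)%N ->
    fexp L n = \sum_(k < N) k`!%:R^-1 * iter k (vect_act L) fpsX n.
  move=> ltnN; have [K hK] := fexpP L fpsX n.
  have agX : fps_agree N fpsX ('X : {poly R}) by move=> i _; rewrite coefX.
  rewrite (vect_act_series L ltnN agX ltnN).
  (* The length [maxn K n.+1] is past the stabilization index [K] and also exceeds [n]. *)
  rewrite -(vect_act_series L ltnN agX (leq_maxr K n.+1)) hK ?leq_maxl //.
  by rewrite /T_op fps_compX ?Diff_coef0.
apply: (@le_trans _ _ (series (exp_coeff B) N)); last first.
  apply: (nondecreasing_cvgn_le _ (is_cvg_series_exp_coeff (R := R) B)).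
  by apply: nondecreasing_series => n _ _; exact: exp_coeff_ge0.
rewrite /series /= big_mkord.
apply: (@le_trans _ _ (\sum_(k < N) k`!%:R^-1 * wnorm s N (iter k (vect_act L) fpsX))).
  rewrite /wnorm; under [leRHS]eq_bigr do rewrite mulr_sumr.
  rewrite exchange_big /=; apply: ler_sum => n _; rewrite coefE //.
  under [leRHS]eq_bigr do rewrite mulrA.
  rewrite -mulr_suml ler_wpM2r //; apply: le_trans (ler_norm_sum _ _ _) _.
  by apply: ler_sum => k _; rewrite normrM ger0_norm.
by apply: ler_sum => k _; rewrite /exp_coeff mulrC ler_wpM2r.
Qed.

End ExpBound.

Lemma vect_at_bound {R : realType} (L : vect R) (s : R) : 0 < s ->
  vect_at (2 * s) L ->
  exists B, forall N, \sum_(j < N) `|L j| * (s ^+ j / j`!%:R) <= B.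
Proof.
move=> s0; rewrite /vect_at /= => fin.
set t := fun j => `|L j| * (2 * s) ^+ j / (j.+1)`!%:R in fin.
have t0 j : 0 <= t j by rewrite divr_ge0 // mulr_ge0 // exprn_ge0 // mulr_ge0 // ltW.
exists (fine (\sum_(1 <= j <oo) (t j)%:E)%E) => N.
rewrite -lee_fin fineK; last first.
  by rewrite ge0_fin_numE // nneseries_ge0 // => n _ _; rewrite lee_fin.
apply: le_trans (nneseries_lim_ge N _); last by move=> n _ _; rewrite lee_fin.
rewrite sumEFin lee_fin -(big_mkord xpredT (fun j => `|L j| * (s ^+ j / j`!%:R))).
(* The series at [2 * s] starts at index 1; the missing term vanishes because [L 0 = 0]. *)
case: N => [|N]; first by rewrite !big_geq.
rewrite big_nat_recl // vect_coef0 normr0 mul0r add0r big_add1 /=.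
apply: ler_sum => j _; rewrite /t exprMn -mulrA ler_wpM2l //.
rewrite [2 ^+ _ * _]mulrC -mulrA; apply: ler_wpM2l; first by rewrite exprn_ge0 ?(ltW s0).
(* After cancelling factorials, [j + 2 <= 2 ^ (j + 1)] remains. *)
rewrite ler_pdivlMr ?ltr0n ?fact_gt0 // [(j.+2)`!]factS natrM mulrCA mulVf ?mulr1.
  by rewrite -natrX ler_nat ltn_expl.
by rewrite pnatr_eq0 -lt0n fact_gt0.
Qed.

Theorem proposition1p3 (R : realType) (L : vect R) (hL : vect_circ L) :
  Diff_circ (fexp L).
Proof.
move=> s /= s0.
have [B leB] := vect_at_bound s0 (hL (2 * s) (mulr_gt0 (ltr0Sn _ 1) s0)).
rewrite /Diff_at /=; apply: le_lt_trans (ltry (expR B)).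
have t0 j : 0 <= `|fexp L j| * s ^+ j.-1 / j`!%:R.
  by rewrite divr_ge0 // mulr_ge0 // exprn_ge0 // ltW.
apply: lime_le => [|].
  by apply: is_cvg_nneseries => n _ _; rewrite lee_fin.
near=> N; rewrite sumEFin lee_fin; apply: le_trans (wnorm_fexp s0 N leB).
rewrite /wnorm -(big_mkord xpredT (fun n => `|fexp L n| * (s ^+ n.-1 / n`!%:R))).
(* The series defining [Diff_at] starts at index 2, so the nonnegative terms 0 and 1 of [wnorm] are
   split off and dropped. *)
rewrite [leRHS](@big_cat_nat _ _ _ 2) //=; last by near: N; exact: nbhs_infty_ge.
under [X in _ <= _ + X]eq_bigr do rewrite mulrA.
by rewrite lerDr sumr_ge0 // => n _; rewrite mulrA.
Unshelve. all: by end_near.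
Qed.
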